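(* Let $S$ be a complex manifold with $(S,p)\cong(\mathbb{C}^n,0)$, and let $(D,p)=(D_1,p)\cup(D_2,p)$ be a divisor that is splayed at $p\in S$ with splayed components $D_1$ and $D_2$. Then the Hilbert--Samuel polynomials satisfy $$\chi_{D,p}(t)+\chi_{D_1\cap D_2,p}(t)=\chi_{D_1,p}(t)+\chi_{D_2,p}(t).$$
   Context: Work in the complex analytic category. $\mathcal{O}=\mathcal{O}_{S,p}\cong\mathbb{C}\{x_1,\dots,x_n\}$ is the local ring of germs of holomorphic functions at $p$, with maximal ideal $\mathfrak{m}$. A divisor is a hypersurface; its local defining equations are always taken reduced (square-free). Splayed: $(D,p)=(D_1,p)\cup(D_2,p)$ is splayed at $p$ (with splayed components $D_1,D_2$) if there exist complex coordinates $(x_1,\dots,x_n)$ at $p$ and an integer $1\le k\le n-1$ such that $D$ is defined by $h_1(x_1,\dots,x_k)\,h_2(x_{k+1},\dots,x_n)$, where $h_i$ is a reduced defining equation of $D_i$ at $p$ ($i=1,2$; the $h_i$ need not be irreducible, and $p\in D_1\cap D_2$). Hilbert--Samuel polynomial: for a finitely generated $\mathcal{O}$-module $M$, $\chi_M^{\mathfrak{m}}$ is the polynomial with rational coefficients such that $\chi_M^{\mathfrak{m}}(d)=\operatorname{length}(M/\mathfrak{m}^dM)$ for all sufficiently large integers $d$. With $h_1,h_2$ reduced equations of $D_1,D_2$ at $p$, set $\chi_{D_i,p}=\chi^{\mathfrak{m}}_{\mathcal{O}/(h_i)}$, $\chi_{D,p}=\chi^{\mathfrak{m}}_{\mathcal{O}/(h_1h_2)}$,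 and $\chi_{D_1\cap D_2,p}=\chi^{\mathfrak{m}}_{\mathcal{O}/(h_1,h_2)}$. *)

(* Defs.v *)
(* Complex numbers are R[i] for an arbitrary R : realType; multi-indices are the
   'X_{1..n} of multinomials. *)
From HB Require Import structures.
From mathcomp Require Import all_boot all_order all_algebra.
From mathcomp Require Import complex.
From mathcomp Require Import mpoly.
From mathcomp Require Import boolp reals.

Set Implicit Arguments.
Unset Strict Implicit.
Unset Printing Implicit Defensive.

Import Order.TTheory GRing.Theory Num.Theory.
Local Open Scope ring_scope.
Local Open Scope quotient_scope.

(* Formal power series in n variables, given by their coefficients. *)
Record fpseries (n : nat) (K : Type) :=
  FPSeries { fpcoef :> 'X_{1..n} -> K }.

Section FormalPowerSeries.
Variables (n : nat) (K : comNzRingType).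
Implicit Types (f g h : fpseries n K) (p q : {mpoly K[n]}).

Lemma fpseriesP f g : (forall m, f m = g m) -> f = g.
Proof. by case: f g => [f] [g] /= e; congr FPSeries; apply/funext. Qed.

HB.instance Definition _ := gen_eqMixin (fpseries n K).
HB.instance Definition _ := gen_choiceMixin (fpseries n K).

Definition fps0 := FPSeries (fun _ : 'X_{1..n} => 0 : K).
Definition fps1 := FPSeries (fun m : 'X_{1..n} => (m == 0%MM)%:R : K).
Definition fps_opp f := FPSeries (fun m => - f m).
Definition fps_add f g := FPSeries (fun m => f m + g m).
Definition fps_mul f g := FPSeries (fun m =>
  \sum_(k : 'X_{1..n < (mdeg m).+1, (mdeg m).+1} | m == (k.1 + k.2)%MM)
     f k.1 * g k.2).

Let agree d p f := forall k, (mdeg k < d)%N -> p@_k = f k.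

Let trunc d f : {mpoly K[n]} := \sum_(m : 'X_{1..n < d}) f m *: 'X_[m].

Let truncP d f : agree d (trunc d f) f.
Proof. by move=> k kd; rewrite mcoeff_mpoly. Qed.

Let agreeM d p q f g : agree d p f -> agree d q g -> agree d (p * q) (fps_mul f g).
Proof.
move=> pf qg m md; rewrite mcoeffM /=; apply: eq_bigr => -[k1 k2] _ /=.
have lt (k : 'X_{1..n < (mdeg m).+1}) : (mdeg k < d)%N.
  exact: leq_trans (bmdeg k) md.
by rewrite pf ?qg.
Qed.

Let agreeD d p q f g : agree d p f -> agree d q g -> agree d (p + q) (fps_add f g).
Proof. by move=> pf qg m md; rewrite mcoeffD pf ?qg. Qed.

Let agree1 d : agree d 1 fps1.
Proof. by move=> m _; rewrite mcoeff1. Qed.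

Let agree_eq f g : (forall d, exists p, agree d p f /\ agree d p g) -> f = g.
Proof.
move=> H; apply: fpseriesP => m; have [q [qf qg]] := H (mdeg m).+1.
by rewrite -qf // qg.
Qed.

Lemma fps_addA : associative fps_add.
Proof. by move=> f g h; apply: fpseriesP => m /=; rewrite addrA. Qed.
Lemma fps_addC : commutative fps_add.
Proof. by move=> f g; apply: fpseriesP => m /=; rewrite addrC. Qed.
Lemma fps_add0 : left_id fps0 fps_add.
Proof. by move=> f; apply: fpseriesP => m /=; rewrite add0r. Qed.
Lemma fps_addN : left_inverse fps0 fps_opp fps_add.
Proof. by move=> f; apply: fpseriesP => m /=; rewrite addNr. Qed.

HB.instance Definition _ :=
  GRing.isZmodule.Build (fpseries n K) fps_addA fps_addC fps_add0 fps_addN.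

Lemma fps_mulA : associative fps_mul.
Proof.
move=> f g h; apply: agree_eq => d; exists (trunc d f * trunc d g * trunc d h).
split; last by do 2?apply: agreeM; apply: truncP.
by rewrite -mulrA; do 2?apply: agreeM; apply: truncP.
Qed.
Lemma fps_mulC : commutative fps_mul.
Proof.
move=> f g; apply: agree_eq => d; exists (trunc d f * trunc d g).
by split; last rewrite mulrC; apply: agreeM; apply: truncP.
Qed.
Lemma fps_mul1 : left_id fps1 fps_mul.
Proof.
move=> f; apply: agree_eq => d; exists (1 * trunc d f).
by split; [apply: agreeM; [apply: agree1|] | rewrite mul1r]; apply: truncP.
Qed.
Lemma fps_mulDl : left_distributive fps_mul fps_add.
Proof.
move=> f g h; apply: agree_eq => d.
exists ((trunc d f + trunc d g) * trunc d h); split.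
  by apply: agreeM; [apply: agreeD|]; apply: truncP.
by rewrite mulrDl; apply: agreeD; apply: agreeM; apply: truncP.
Qed.
Lemma fps_oner_neq0 : fps1 != fps0.
Proof.
apply/eqP => /(congr1 (fun f : fpseries n K => f 0%MM)) /= /eqP.
by rewrite eqxx oner_eq0.
Qed.

HB.instance Definition _ := GRing.Zmodule_isComNzRing.Build (fpseries n K)
  fps_mulA fps_mulC fps_mul1 fps_mulDl fps_oner_neq0.

Lemma fps_mulE d f g m : (mdeg m < d)%N ->
  (f * g) m = \sum_(k : 'X_{1..n < d, d} | m == (k.1 + k.2)%MM) f k.1 * g k.2.
Proof.
move=> md; rewrite -(agreeM (@truncP d f) (@truncP d g)) // (mcoeff_poly_mul _ _ md).
by apply: eq_bigr => k _; rewrite !truncP ?bmdeg.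
Qed.

End FormalPowerSeries.

Section ConvergentPowerSeries.
Variables (n : nat) (K : numFieldType).

(* Absolute summability of the coefficients on some polydisc of polyradius
   (r, ..., r); the partial sums run over the multi-indices of degree < N. *)
Definition convergent : {pred fpseries n K} := fun f =>
  `[< exists r M : K, 0 < r /\
        forall N, \sum_(m : 'X_{1..n < N}) `|f m| * r ^+ mdeg m <= M >].

Lemma convergent2 (f g : fpseries n K) : f \in convergent -> g \in convergent ->
  exists r M M' : K, [/\ 0 < r,
    forall N, \sum_(m : 'X_{1..n < N}) `|f m| * r ^+ mdeg m <= M &
    forall N, \sum_(m : 'X_{1..n < N}) `|g m| * r ^+ mdeg m <= M'].
Proof.
move=> /asboolP[r [M [r0 fM]]] /asboolP[s [M' [s0 gM]]].
have shrink (h : fpseries n K) (t u L : K) : 0 < t -> t <= u ->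
    (forall N, \sum_(m : 'X_{1..n < N}) `|h m| * u ^+ mdeg m <= L) ->
    forall N, \sum_(m : 'X_{1..n < N}) `|h m| * t ^+ mdeg m <= L.
  move=> t0 tu hL N; apply: le_trans (hL N); apply: ler_sum => m _.
  by apply: ler_wpM2l => //; apply: lerXn2r => //; rewrite nnegrE ltW // (lt_le_trans t0).
have /orP[rs|sr] := real_leVge (gtr0_real r0) (gtr0_real s0).
- by exists r, M, M'; split=> //; apply: shrink gM.
- by exists s, M, M'; split=> //; apply: shrink fM.
Qed.

Lemma convergent_subring : subring_closed convergent.
Proof.
split=> [|f g /convergent2/[apply]|f g /convergent2/[apply]].
- apply/asboolP; exists 1, 1; split=> // -[|N].
    by rewrite big_pred0 // => -[m]; rewrite ltn0.
  have N0 : (mdeg (0%MM : 'X_{1..n}) < N.+1)%N by rewrite mdeg0.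
  rewrite (bigD1 (BMultinom N0)) //= mdeg0 big1 ?addr0 => [|m mN0].
    by rewrite expr1n mulr1 eqxx normr1.
  by rewrite bmeqP /= in mN0; rewrite (negPf mN0) normr0 mul0r.
- move=> [r [M [M' [r0 fM gM]]]]; apply/asboolP; exists r, (M + M'); split=> // N.
  apply: le_trans (lerD (fM N) (gM N)); rewrite -big_split /=.
  apply: ler_sum => m _; rewrite -mulrDl; apply: ler_wpM2r; last exact: ler_normB.
  exact/exprn_ge0/ltW.
- move=> [r [M [M' [r0 fM gM]]]]; apply/asboolP; exists r, (M * M'); split=> // N.
  pose a (h : fpseries n K) (m : 'X_{1..n}) := `|h m| * r ^+ mdeg m.
  have a0 h m : 0 <= a h m by rewrite mulr_ge0 // exprn_ge0 // ltW.
  have S0 h : 0 <= \sum_(m : 'X_{1..n < N}) a h m by apply: sumr_ge0.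
  apply: le_trans (ler_pM (S0 f) (S0 g) (fM N) (gM N)).
  rewrite big_distrlr pair_bigA /=.
  have le1 (m : 'X_{1..n < N}) : `|(f * g) m| * r ^+ mdeg m <=
      \sum_(k : 'X_{1..n < N, N} | bmnm m == (k.1 + k.2)%MM) a f k.1 * a g k.2.
    rewrite (fps_mulE _ _ (bmdeg m)).
    apply: le_trans (ler_wpM2r (exprn_ge0 _ (ltW r0)) (ler_norm_sum _ _ _)) _.
    rewrite mulr_suml; apply: ler_sum => k /eqP ->.
    by rewrite normrM mdegD exprD /a mulrACA.
  apply: le_trans (ler_sum _ (fun m _ => le1 m)) _.
  rewrite (exchange_big_dep xpredT) //=; apply: ler_sum => k _.
  have [kN|kN] := ltnP (mdeg (k.1 + k.2)%MM) N.
    by rewrite (big_pred1 (BMultinom kN)) // => m; rewrite /= bmeqP.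
  rewrite big_pred0 => [|m]; first exact: (mulr_ge0 (a0 _ _) (a0 _ _)).
  apply/negbTE/negP => /eqP mk.
  by move: (bmdeg m); rewrite mk ltnNge kN.
Qed.

HB.instance Definition _ :=
  GRing.isSubringClosed.Build (fpseries n K) convergent convergent_subring.

Record cpseries := CPSeries { cps_val :> fpseries n K; _ : cps_val \in convergent }.

HB.instance Definition _ := [isSub for cps_val].
HB.instance Definition _ := [Choice of cpseries by <:].
HB.instance Definition _ := [SubChoice_isSubComNzRing of cpseries by <:].

End ConvergentPowerSeries.

Section Modules.
Variables (A : comNzRingType) (V : lmodType A).

(* The smallest submodule containing X. *)
Definition submod_span (X : V -> Prop) : {pred V} := fun v =>
  `[< forall N : {pred V}, submod_closed N -> (forall x, X x -> x \in N) ->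
        v \in N >].

Lemma submod_span_closed (X : V -> Prop) : submod_closed (submod_span X).
Proof.
split=> [|a u v /asboolP Hu /asboolP Hv]; apply/asboolP => N Ncl XN.
  by case: Ncl.
by case: (Ncl) => _; apply; [apply: Hu | apply: Hv].
Qed.

HB.instance Definition _ (X : V -> Prop) :=
  GRing.isSubmodClosed.Build A V (submod_span X) (submod_span_closed X).

Section QuotientModule.
Variable X : V -> Prop.

Definition lmod_quot := @Quotient.quot V (submod_span X).

HB.instance Definition _ := GRing.Zmodule.on lmod_quot.
HB.instance Definition _ := EqQuotient.on lmod_quot.

Definition lmod_quot_scale (a : A) (u : lmod_quot) : lmod_quot :=
  \pi_lmod_quot (a *: repr u).

Lemma pi_lmod_quot_scale a v :
  lmod_quot_scale a (\pi_lmod_quot v) = \pi_lmod_quot (a *: v).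
Proof.
apply/eqP; rewrite -Quotient.idealrBE -scalerBr rpredZ //.
by rewrite Quotient.idealrBE reprK.
Qed.

Lemma pi_lmod_quotD (u v : V) :
  \pi_lmod_quot (u + v) = \pi_lmod_quot u + \pi_lmod_quot v.
Proof. exact: Quotient.pi_add. Qed.

Lemma lmod_quot_reprK (u : lmod_quot) : exists v, u = \pi_lmod_quot v.
Proof. by exists (repr u); rewrite reprK. Qed.

Fact lmod_quot_scaleA a b u :
  lmod_quot_scale a (lmod_quot_scale b u) = lmod_quot_scale (a * b) u.
Proof. by have [v ->] := lmod_quot_reprK u; rewrite !pi_lmod_quot_scale scalerA. Qed.
Fact lmod_quot_scale1 : left_id 1 lmod_quot_scale.
Proof.
by move=> u; have [v ->] := lmod_quot_reprK u; rewrite pi_lmod_quot_scale scale1r.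
Qed.
Fact lmod_quot_scaleDr : right_distributive lmod_quot_scale +%R.
Proof.
move=> a u v; have [u' ->] := lmod_quot_reprK u; have [v' ->] := lmod_quot_reprK v.
by rewrite -pi_lmod_quotD !pi_lmod_quot_scale scalerDr pi_lmod_quotD.
Qed.
Fact lmod_quot_scaleDl u :
  {morph (fun a => lmod_quot_scale a u) : a b / a + b}.
Proof.
move=> a b; have [v ->] := lmod_quot_reprK u; rewrite !pi_lmod_quot_scale.
by rewrite scalerDl pi_lmod_quotD.
Qed.

HB.instance Definition _ := GRing.Zmodule_isLmodule.Build A lmod_quot
  lmod_quot_scaleA lmod_quot_scale1 lmod_quot_scaleDr lmod_quot_scaleDl.

End QuotientModule.

(* Strictly increasing chains N 0 < N 1 < ... < N l of submodules; the length of
   a module is the greatest l for which there is one. *)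
Definition submod_chain (l : nat) := exists N : nat -> {pred V},
  (forall i, (i <= l)%N -> submod_closed (N i)) /\
  (forall i, (i < l)%N ->
     {subset N i <= N i.+1} /\ exists2 x, x \in N i.+1 & x \notin N i).

Definition module_length (l : nat) :=
  submod_chain l /\ forall l', submod_chain l' -> (l' <= l)%N.

End Modules.

Section HilbertSamuel.
Variable A : comNzRingType.

Definition ideal_pow (I : {pred A}) (d : nat) : {pred A} :=
  submod_span (fun x : A^o =>
    exists2 a : 'I_d -> A, (forall i, a i \in I) & x = \prod_i a i).

Definition ideal_mul_mod (I : {pred A}) (V : lmodType A) : V -> Prop :=
  fun v => exists a w, a \in I /\ v = a *: w.

(* V / I^d V, for A-modules V; lmod_quot X is V modulo the submodule spanned
   by X. *)
Definition mod_pow_quot (I : {pred A}) (V : lmodType A) (d : nat) : lmodType A :=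
  lmod_quot (@ideal_mul_mod (ideal_pow I d) V).

Definition hilbert_samuel_poly (I : {pred A}) (V : lmodType A)
    (P : {poly rat}) :=
  exists d0, forall d, (d0 <= d)%N ->
    exists2 l, module_length (mod_pow_quot I V d) l & P.[d%:R] = l%:R.

Definition quot1 (h : A) : lmodType A := lmod_quot (fun x : A^o => x = h).

Definition quot2 (h1 h2 : A) : lmodType A :=
  lmod_quot (fun x : A^o => x = h1 \/ x = h2).

Lemma module_length_uniq (V : lmodType A) l l' :
  module_length V l -> module_length V l' -> l = l'.
Proof.
by move=> [Vl maxl] [Vl' maxl']; apply/eqP; rewrite eqn_leq maxl' ?maxl.
Qed.

Lemma hilbert_samuel_poly_uniq (I : {pred A}) (V : lmodType A) P Q :
  hilbert_samuel_poly I V P -> hilbert_samuel_poly I V Q -> P = Q.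
Proof.
move=> [d0 HP] [d1 HQ]; apply/eqP; rewrite -subr_eq0; apply/eqP.
pose d := maxn d0 d1; pose rs := [seq (d + i)%:R : rat | i <- iota 0 (size (P - Q))].
apply: (@roots_geq_poly_eq0 _ _ rs).
- apply/allP => _ /mapP[i _ ->]; rewrite rootE hornerD hornerN.
  have [l Hl ->] := HP (d + i)%N (leq_trans (leq_maxl d0 d1) (leq_addr _ _)).
  have [l' Hl' ->] := HQ (d + i)%N (leq_trans (leq_maxr d0 d1) (leq_addr _ _)).
  by rewrite (module_length_uniq Hl Hl') subrr.
- rewrite map_inj_uniq ?iota_uniq // => i j /eqP.
  by rewrite eqr_nat eqn_add2l => /eqP.
- by rewrite size_map size_iota.
Qed.

Definition is_unit (u : A) := exists v, u * v = 1.

Definition associates (f h : A) := exists2 u, is_unit u & f = u * h.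

Definition squarefree (f : A) := forall a b, f = a ^+ 2 * b -> is_unit a.

End HilbertSamuel.

(* The local ring of germs of holomorphic functions at a point of an
   n-dimensional complex manifold, written in some fixed coordinates centred
   at that point. *)
Notation germ R n := (cpseries n (complex R)).

Section Germs.
Variables (R : realType) (n : nat).

Implicit Types (f g h : germ R n) (x : 'I_n -> germ R n).

Definition germ_max : {pred germ R n} := fun f => f 0%MM == 0.

(* A germ of divisor is given by a reduced equation, which is unique up to a
   unit. *)
Definition reduced_equation h := [/\ h != 0, h \in germ_max & squarefree h].

(* The coefficient of U_(j) in x i is the partial derivative of x i at the
   origin with respect to the j-th variable. *)
Definition coordinates x :=
  (forall i, x i \in germ_max) /\
  \matrix_(i < n, j < n) x i U_(j)%MM \in unitmx.

(* f = g(x_1, ..., x_n): as the x_i vanish at the origin, only the monomials of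
   g of degree at most |m| contribute to the coefficient of index m. *)
Definition is_subst g x f := forall m : 'X_{1..n},
  f m = \sum_(b : 'X_{1..n < (mdeg m).+1}) g b * (\prod_(i < n) x i ^+ b i) m.

Definition involves_only (D : pred 'I_n) g :=
  forall m i, g m != 0 -> ~~ D i -> m i = 0%N.

(* The divisors D_1, D_2 with reduced equations h1, h2 are the splayed components
   of their union. Series in x_1, ..., x_k, resp. in x_{k+1}, ..., x_n, are
   series g1, resp. g2, in n variables in which the other variables do not
   occur; f1 and f2 are the reduced equations g1(x) of D_1 and g2(x) of D_2. *)
Definition splayed h1 h2 :=
  exists (k : nat) x g1 g2 f1 f2,
    [/\ (1 <= k <= n - 1)%N, coordinates x,
        involves_only (fun i => i < k)%N g1 /\ is_subst g1 x f1,
        involves_only (fun i => k <= i)%N g2 /\ is_subst g2 x f2 &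
        associates f1 h1 /\ associates f2 h2].

End Germs.

(* Main.v *)
(* Everything is read off modulo m^d, in the coefficient space K^N of series
   truncated at degree d: the length of O/(J + m^d) is the corank N - rank U of
   the image U of J. The image of (h) has the dimension N(d - e) of the space of
   series truncated at degree d - e, where e is the order of h, and N(d) is a
   binomial polynomial in d; so the three principal ideals have Hilbert-Samuel
   polynomials. Splayedness gives U_{h1} :&: U_{h2} = U_{h1 h2} for every d, and
   rank (U1 + U2) + rank (U1 :&: U2) = rank U1 + rank U2 then yields both the
   fourth polynomial and the identity.

   The equality of images is Buchberger's criterion for coprime leading
   monomials: in the splitting coordinates the lowest monomials of h1 and h2
   involve disjoint sets of variables, so a relation a1 h1 = a2 h2 mod m^d
   reduces, one lowest monomial at a time, to a multiple of h1 h2. The change of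
   coordinates is only needed on truncated polynomials, where the inverse of its
   linear part inverts it degree by degree. *)
Require Import Defs.
From mathcomp Require Import all_boot all_order all_algebra.
From mathcomp Require Import complex.
From mathcomp Require Import mpoly.
From mathcomp Require Import boolp reals.
From mathcomp Require Import ring.

Set Implicit Arguments.
Unset Strict Implicit.
Unset Printing Implicit Defensive.

Import Order.TTheory GRing.Theory Num.Theory.
Local Open Scope ring_scope.

(** * Polynomials modulo a power of the maximal ideal *)

Section Vanishing.
Variables (n : nat) (K : fieldType).
Implicit Types (p q f g : {mpoly K[n]}) (x y : n.-tuple {mpoly K[n]}).

Definition vanish d p := forall m : 'X_{1..n}, (mdeg m < d)%N -> p@_m = 0.

Lemma vanish_le d e p : (d <= e)%N -> vanish e p -> vanish d p.
Proof. by move=> de pe m md; apply: pe; apply: leq_trans de. Qed.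

Lemma vanish0 d : vanish d 0.
Proof. by move=> m _; rewrite mcoeff0. Qed.

Lemma vanishD d p q : vanish d p -> vanish d q -> vanish d (p + q).
Proof. by move=> pd qd m md; rewrite mcoeffD pd ?qd ?addr0. Qed.

Lemma vanishN d p : vanish d p -> vanish d (- p).
Proof. by move=> pd m md; rewrite mcoeffN pd ?oppr0. Qed.

Lemma vanishB d p q : vanish d p -> vanish d q -> vanish d (p - q).
Proof. by move=> pd qd; apply/vanishD/vanishN. Qed.

Lemma vanish_sum d (I : Type) (r : seq I) (P : pred I) (F : I -> {mpoly K[n]}) :
  (forall i, P i -> vanish d (F i)) -> vanish d (\sum_(i <- r | P i) F i).
Proof.
by move=> H; apply: (big_ind (vanish d)) => //; [exact: vanish0|exact: vanishD].
Qed.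

Lemma vanishZ d c p : vanish d p -> vanish d (c *: p).
Proof. by move=> pd m md; rewrite mcoeffZ pd ?mulr0. Qed.

Lemma vanishM d e p q : vanish d p -> vanish e q -> vanish (d + e) (p * q).
Proof.
move=> pd qe m md; rewrite mcoeffM big1 // => -[[k _] [l _]] /= /eqP mE.
have [kd|dk] := ltnP (mdeg k) d; first by rewrite pd ?mul0r.
rewrite [X in _ * X]qe ?mulr0 //.
move: md; rewrite mE mdegD => md.
by rewrite -(ltn_add2l d) (leq_ltn_trans _ md) ?leq_add2r.
Qed.

Lemma vanishMl d p q : vanish d q -> vanish d (p * q).
Proof. by move=> qd; apply: (@vanishM 0). Qed.

Lemma vanishMr d p q : vanish d p -> vanish d (p * q).
Proof. by rewrite mulrC; apply: vanishMl. Qed.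

Lemma vanish_monomial (m : 'X_{1..n}) : vanish (mdeg m) 'X_[m].
Proof. by move=> k km; rewrite mcoeffX; case: eqP km => // ->; rewrite ltnn. Qed.

Lemma vanish_exp d p k : vanish d p -> vanish (d * k) (p ^+ k).
Proof.
move=> pd; elim: k => [|k IH]; first by rewrite muln0.
by rewrite exprS mulnS; apply: vanishM.
Qed.

Lemma vanish_comp d p x :
  (forall i, vanish 1 (tnth x i)) -> vanish d p -> vanish d (p \mPo x).
Proof.
move=> x1 pd; rewrite comp_mpolyEX big_seq; apply: vanish_sum => m mp.
apply/vanishZ/(@vanish_le _ (mdeg m)).
  by rewrite leqNgt; apply/negP => /pd/eqP; rewrite mcoeff_eq0 mp.
rewrite comp_mpolyX mdegE.
apply: (big_ind2 vanish) => // [d1 p1 d2 p2|i _]; first exact: vanishM.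
by rewrite -[X in vanish X]mul1n; apply: vanish_exp.
Qed.

(* [f] and [g] vanish below degree [d] and have the same homogeneous part of
   degree [d]. *)
Definition same_part d f g := vanish d g /\ vanish d.+1 (f - g).

Lemma same_partM d e f f' g g' :
  same_part d f f' -> same_part e g g' -> same_part (d + e) (f * g) (f' * g').
Proof.
move=> [f'd ff'] [g'e gg']; split; first exact: vanishM.
have -> : f * g - f' * g' = (f - f') * (g - g') + (f - f') * g' + f' * (g - g').
  by ring.
apply: vanishD; last by rewrite -addnS; apply: vanishM.
apply: vanishD; last by rewrite -addSn; apply: vanishM.
by apply: (@vanish_le _ (d.+1 + e.+1)); [rewrite addSn ltnS leq_add2l | apply: vanishM].
Qed.

Lemma same_part_exp d f g k : same_part d f g -> same_part (d * k) (f ^+ k) (g ^+ k).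
Proof.
move=> fg; elim: k => [|k IH]; last by rewrite !exprS mulnS; apply: same_partM.
by rewrite muln0 !expr0; split=> //; rewrite subrr; apply: vanish0.
Qed.

(** Checked monomial by monomial: a substitution tangent to the identity is the identity to leading
    order, in whatever degree [p] starts. *)
Lemma same_part_comp d p x : (forall i, same_part 1 (tnth x i) 'X_i) ->
  vanish d p -> same_part d (p \mPo x) p.
Proof.
move=> xX pd; split=> //.
rewrite comp_mpolyEX [X in _ - X]mpolyE -sumrB big_seq; apply: vanish_sum => m mp.
rewrite -scalerBr; apply/vanishZ/(@vanish_le _ (mdeg m).+1).
  by rewrite ltnS leqNgt; apply/negP => /pd/eqP; rewrite mcoeff_eq0 mp.
suff [] : same_part (mdeg m) ('X_[m] \mPo x) 'X_[m] by [].
rewrite comp_mpolyX [X in same_part _ _ X]mpolyXE_id mdegE.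
apply: (big_rec3 same_part) => [|i e f g _ fg].
  by split=> //; rewrite subrr; apply: vanish0.
by apply: same_partM => //; rewrite -[X in same_part X]mul1n; apply: same_part_exp.
Qed.

Lemma comp_mpolyA p x y :
  (p \mPo y) \mPo x = p \mPo [tuple tnth y i \mPo x | i < n].
Proof.
rewrite [p \mPo y]comp_mpolyEX [RHS]comp_mpolyEX raddf_sum; apply: eq_bigr => m _.
rewrite /= comp_mpolyZ !comp_mpolyX rmorph_prod; congr (_ *: _).
by apply: eq_bigr => i _; rewrite rmorphXn tnth_mktuple.
Qed.

(** * Inverting a change of coordinates degree by degree *)

Section CoordinateChange.
Variables (x : n.-tuple {mpoly K[n]}).
Hypothesis x1 : forall i, vanish 1 (tnth x i).

Let L := \matrix_(i < n, j < n) (tnth x i)@_U_(j).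
Hypothesis unitL : L \in unitmx.

(** Inverse to [x] only to leading order; the inductions on the degree below need no more. *)
Let y := [tuple \sum_j invmx L i j *: 'X_j | i < n].

Let vanishX i : vanish 1 ('X_i : {mpoly K[n]}).
Proof. by rewrite -(mdeg1 i); apply: vanish_monomial. Qed.

Let y1 i : vanish 1 (tnth y i).
Proof. by rewrite tnth_mktuple; apply: vanish_sum => j _; apply: vanishZ. Qed.

Let linear_part i : vanish 2 (tnth x i - \sum_j L i j *: 'X_j).
Proof.
move=> m; rewrite ltnS leq_eqVlt ltnS leqn0 => /orP[/mdeg1P[j /eqP ->]|].
  rewrite mcoeffB raddf_sum (bigD1 j) //= mcoeffZ mcoeffXU eqxx mulr1 mxE.
  rewrite big1 ?addr0 ?subrr // => k kj.
  by rewrite mcoeffZ mcoeffXU (negPf kj) mulr0.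
move=> /eqP m0; rewrite mcoeffB x1 ?m0 // raddf_sum big1 ?subr0 // => j _.
by rewrite /= (vanishZ _ (@vanishX j)) ?m0.
Qed.

(** Both composites of [x] and [y] reduce to it: [z] is [x] with [N := L], or [y] with
    [N := invmx L]. *)
Let lin_comp (M N : 'M[K]_n) i (z : n.-tuple {mpoly K[n]}) :
  (forall i, vanish 2 (tnth z i - \sum_j N i j *: 'X_j)) -> M *m N = 1%:M ->
  same_part 1 (\sum_j M i j *: tnth z j) 'X_i.
Proof.
move=> zN MN; split=> //.
have -> : 'X_i = \sum_j M i j *: (\sum_k N j k *: 'X_k) :> {mpoly K[n]}.
  under eq_bigr do rewrite scaler_sumr.
  rewrite exchange_big /=.
  transitivity (\sum_k (M *m N) i k *: 'X_k : {mpoly K[n]}).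
    rewrite MN (bigD1 i) //= mxE eqxx scale1r big1 ?addr0 // => k ki.
    by rewrite mxE eq_sym (negPf ki) scale0r.
  apply: eq_bigr => k _; rewrite mxE scaler_suml.
  by apply: eq_bigr => j _; rewrite scalerA.
rewrite -sumrB; apply: vanish_sum => j _.
by rewrite -scalerBr; apply/vanishZ/zN.
Qed.

Let same_part_yx d p : vanish d p -> vanish d.+1 ((p \mPo y) \mPo x - p).
Proof.
rewrite comp_mpolyA => pd; apply: (proj2 (same_part_comp _ pd)) => i.
rewrite !tnth_mktuple raddf_sum /=.
under eq_bigr do rewrite comp_mpolyZ comp_mpolyXU -tnth_nth.
by apply: lin_comp linear_part _; rewrite mulVmx.
Qed.

Let same_part_xy d p : vanish d p -> vanish d.+1 ((p \mPo x) \mPo y - p).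
Proof.
rewrite comp_mpolyA => pd; apply: (proj2 (same_part_comp _ pd)) => i.
rewrite !tnth_mktuple.
rewrite -[tnth x i](subrK (\sum_j L i j *: 'X_j)) comp_mpolyD.
have [_ e] : same_part 1 ((\sum_j L i j *: 'X_j) \mPo y) 'X_i.
  rewrite raddf_sum /=; under eq_bigr do rewrite comp_mpolyZ comp_mpolyXU -tnth_nth.
  apply: (@lin_comp _ (invmx L)); last by rewrite mulmxV.
  by move=> j; rewrite tnth_mktuple subrr; apply: vanish0.
split=> //; rewrite -addrA; apply: vanishD => //.
exact: vanish_comp y1 (linear_part i).
Qed.

Lemma vanish_comp_inj d p : vanish d (p \mPo x) -> vanish d p.
Proof.
move=> pxd; suff H : forall s, (s <= d)%N -> vanish s p by exact: H.
elim=> // s IH sd; have ps := IH (ltnW sd).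
(* The round trip through [x] and [y] changes [p] only from degree [s.+1] on, and its result
   vanishes below degree [d]. *)
rewrite -[p](subKr ((p \mPo x) \mPo y)); apply: vanishB; last exact: same_part_xy.
by apply: vanish_le sd _; apply: vanish_comp.
Qed.

Lemma comp_mpoly_surj d f : exists p, vanish d (f - (p \mPo x)).
Proof.
elim: d => [|d [p pd]]; first by exists 0.
(* Successive correction: the error vanishes below degree [d], and its composite with [y] cancels
   its part of degree [d]. *)
exists (p + ((f - (p \mPo x)) \mPo y)).
rewrite comp_mpolyD opprD addrA -opprB; apply: vanishN; exact: same_part_yx.
Qed.

End CoordinateChange.

(** * Lowest monomials and syzygies *)

Lemma mlast_mcoeff_neq0 p : p != 0 -> p@_(mlast p) != 0.
Proof. by move=> /mlast_supp; rewrite mcoeff_msupp. Qed.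

(** [a] and [b] are mere lower bounds, possibly outside the supports. The monomial order is
    compatible with addition, so only the pair [(a, b)] can contribute to the coefficient at
    [a + b]. *)
Lemma mcoeffM_low p q a b :
  (forall k, (k < a)%O -> p@_k = 0) -> (forall k, (k < b)%O -> q@_k = 0) ->
  (forall k, (k < (a + b)%MM)%O -> (p * q)@_k = 0) /\
  (p * q)@_(a + b) = p@_a * q@_b.
Proof.
move=> pa qb; split=> [m mab|].
  rewrite mcoeffM big1 // => -[[k _] [l _]] /= /eqP mE.
  have [/pa->|ak] := ltP k a; first by rewrite mul0r.
  have [/qb->|bl] := ltP l b; first by rewrite mulr0.
  by move: mab; rewrite mE ltNge lem_add.
have da : (mdeg a < (mdeg (a + b)).+1)%N by rewrite ltnS mdegD leq_addr.
have db : (mdeg b < (mdeg (a + b)).+1)%N by rewrite ltnS mdegD leq_addl.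
rewrite mcoeffM (bigD1 (BMultinom da, BMultinom db)) //= big1 ?addr0 //.
move=> -[[k kd] [l ld]] /= /andP[/eqP mE kl].
have [/pa->|ak] := ltP k a; first by rewrite mul0r.
have [/qb->|bl] := ltP l b; first by rewrite mulr0.
suff [ka lb] : k = a /\ l = b.
  by case/eqP: kl; congr pair; apply: val_inj.
move: ak; rewrite le_eqVlt => /predU1P[ak|ak]; last first.
  by have := ltmc_le_add ak bl; rewrite mE ltxx.
by split=> //; move/addmI: (etrans mE (congr1 (mnm_add^~ l) (esym ak))).
Qed.

Lemma mcoeffM_mlast p q :
  (forall k, (k < (mlast p + mlast q)%MM)%O -> (p * q)@_k = 0) /\
  (p * q)@_(mlast p + mlast q) = p@_(mlast p) * q@_(mlast q).
Proof. by apply: mcoeffM_low => l; apply: mcoeff_lt_mlast. Qed.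

Lemma mlastM p q : p != 0 -> q != 0 -> mlast (p * q) = (mlast p + mlast q)%MM.
Proof.
move=> p0 q0; have [low eq] := mcoeffM_mlast p q.
apply: mlastE => [|m]; rewrite mcoeff_msupp.
  by rewrite eq mulf_neq0 ?mlast_mcoeff_neq0.
by apply: contraNle => /low ->.
Qed.

Definition only_in (D : pred 'I_n) p :=
  forall m i, p@_m != 0 -> ~~ D i -> m i = 0%N.

Lemma only_in_mlast D p i : only_in D p -> ~~ D i -> mlast p i = 0%N.
Proof.
move=> pD Di; have [->|p0] := eqVneq p 0; first by rewrite mlast0 mnm0E.
by apply: pD => //; apply: mlast_mcoeff_neq0.
Qed.

(* The lowest monomials of [P1] and [P2] are coprime, so the lowest monomial of
   a multiple [p * P1] which is also one of [P2] modulo degree [d] can be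
   cancelled by subtracting a multiple of [P2] from [p]. *)
Lemma coprime_syzygy d D p q P1 P2 :
  only_in D P1 -> only_in (predC D) P2 -> vanish d (p * P1 - q * P2) ->
  exists c, vanish d ((p - c * P2) * P1).
Proof.
move=> P1D P2D.
(* Induction measure: the monomials of degree below [d] that are at least the lowest one of
   [p * P1]; cancelling the latter shrinks this set. *)
pose above p := [set k : 'X_{1..n < d} | has (fun j => (j <= bmnm k)%O) (msupp (p * P1))].
have [N] := ubnP #|above p|; elim: N p q => // N IH p q /ltnSE leN pq.
have [r0|r0] := eqVneq (p * P1) 0.
  by exists 0; rewrite mul0r subr0 r0; apply: vanish0.
set nu := mlast (p * P1); have [dnu|nud] := leqP d (mdeg nu).
  exists 0; rewrite mul0r subr0 => k kd.
  by apply/mcoeff_lt_mlast/lt_mdeg_ltmc/(leq_trans kd).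
have nu_supp : (p * P1)@_nu != 0 by apply: mlast_mcoeff_neq0.
have same k : (mdeg k < d)%N -> (q * P2)@_k = (p * P1)@_k.
  by move=> /pq /eqP; rewrite mcoeffB subr_eq0 => /eqP.
have [p0 P10] : p != 0 /\ P1 != 0 by apply/andP; rewrite -negb_or -mulf_eq0.
have [q0 P20] : q != 0 /\ P2 != 0.
  apply/andP; rewrite -negb_or -mulf_eq0; apply: contraNneq nu_supp => qP20.
  by rewrite -same // qP20 mcoeff0.
have nuE : nu = (mlast p + mlast P1)%MM by apply: mlastM.
(* A monomial smaller than [nu] has at most its degree, hence degree below [d], where both products
   agree. *)
have nuE' : nu = (mlast q + mlast P2)%MM.
  rewrite -mlastM //; apply/esym/mlastE => [|m]; rewrite mcoeff_msupp.
    by rewrite same.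
  apply: contraNle => mnu; rewrite same ?(mcoeff_lt_mlast mnu) //.
  exact: leq_ltn_trans (lemc_mdeg (ltW mnu)) nud.
(* Coprimality: outside [D], [P1] contributes nothing to [nu], so [p] carries the whole exponent,
   which includes that of [P2]; inside [D], [P2] has exponent 0. *)
have le2 : (mlast P2 <= mlast p)%MM.
  apply/mnm_lepP => i; have [Di|Di] := boolP (D i).
    by rewrite (only_in_mlast P2D) //= Di.
  move/mnmP: nuE' => /(_ i); rewrite nuE !mnmDE (only_in_mlast P1D) // addn0 => ->.
  exact: leq_addl.
pose kappa := (mlast p - mlast P2)%MM.
have pE : mlast p = (kappa + mlast P2)%MM by rewrite submK.
have qE : mlast q = (kappa + mlast P1)%MM.
  apply: (@addIm _ (mlast P2)); rewrite -nuE' nuE pE -!addmA.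
  by congr mnm_add; apply: addmC.
(* Chosen so that [c0 * P2] has the same lowest term as [p]. *)
pose c0 := (p@_(mlast p) / P2@_(mlast P2)) *: 'X_[kappa] : {mpoly K[n]}.
have [Xlow Xeq] : (forall k, (k < mlast p)%O -> ('X_[kappa] * P2)@_k = 0) /\
    ('X_[kappa] * P2)@_(mlast p) = P2@_(mlast P2).
  have Xk k : (k < kappa)%O -> ('X_[kappa] : {mpoly K[n]})@_k = 0.
    by rewrite mcoeffX; case: eqP => // ->; rewrite ltxx.
  have [] := mcoeffM_low Xk (@mcoeff_lt_mlast _ _ P2).
  by rewrite pE mcoeffX eqxx mul1r.
have p'low k : (k <= mlast p)%O -> (p - c0 * P2)@_k = 0.
  rewrite mcoeffB -scalerAl mcoeffZ le_eqVlt => /predU1P[->|kp].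
    by rewrite Xeq divfK ?subrr ?mlast_mcoeff_neq0.
  by rewrite Xlow // mcoeff_lt_mlast // mulr0 subrr.
have p'P1low k : (k <= nu)%O -> ((p - c0 * P2) * P1)@_k = 0.
  have [low eq] := mcoeffM_low (fun k kp => p'low k (ltW kp)) (@mcoeff_lt_mlast _ _ P1).
  rewrite nuE le_eqVlt => /predU1P[->|/low//].
  by rewrite eq p'low // mul0r.
(* The relation is unchanged: the two terms [c0 * P1 * P2] cancel. *)
have [||c0' c0'P] := IH (p - c0 * P2) (q - c0 * P1).
- apply: leq_trans leN; apply: proper_card; apply/properP; split.
    apply/subsetP => k; rewrite !inE => /hasP[j]; rewrite mcoeff_msupp => j0 jk.
    apply/hasP; exists nu; first by rewrite mcoeff_msupp.
    by apply: le_trans jk; apply: contraNle j0 => /ltW/p'P1low ->.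
  exists (BMultinom nud); rewrite inE /=.
    by apply/hasP; exists nu => //; rewrite mcoeff_msupp.
  by apply/negP => /hasP[j]; rewrite mcoeff_msupp => /eqP + /p'P1low.
- by congr (vanish d _): pq; ring.
by exists (c0 + c0'); congr (vanish d _): c0'P; ring.
Qed.

(** Transports [coprime_syzygy] through the coordinates [x]: surjectivity modulo degree [d] pulls
    back [a1] and [a2], injectivity pulls back the relation. *)
Lemma splayed_syzygy d D x P1 P2 f1 f2 a1 a2 :
  (forall i, vanish 1 (tnth x i)) ->
  \matrix_(i < n, j < n) (tnth x i)@_U_(j) \in unitmx ->
  only_in D P1 -> only_in (predC D) P2 ->
  vanish d (f1 - (P1 \mPo x)) -> vanish d (f2 - (P2 \mPo x)) ->
  vanish d (a1 * f1 - a2 * f2) -> exists c, vanish d (a1 * f1 - c * (f1 * f2)).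
Proof.
move=> x1 unitx P1D P2D f1P f2P a12.
have [p pP] := comp_mpoly_surj x1 unitx d a1.
have [q qP] := comp_mpoly_surj x1 unitx d a2.
have /(vanish_comp_inj x1 unitx)/(coprime_syzygy P1D P2D)[c cP] :
    vanish d ((p * P1 - q * P2) \mPo x).
  rewrite rmorphB !rmorphM /=.
  (* Every correction term has a factor that vanishes below degree [d]. *)
  have -> : (p \mPo x) * (P1 \mPo x) - (q \mPo x) * (P2 \mPo x) =
      a1 * f1 - a2 * f2 - (a1 - (p \mPo x)) * (P1 \mPo x) - a1 * (f1 - (P1 \mPo x))
      + (a2 - (q \mPo x)) * (P2 \mPo x) + a2 * (f2 - (P2 \mPo x)) by ring.
  apply: vanishD (vanishMl _ f2P); apply: vanishD (vanishMr _ qP).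
  by apply: vanishB (vanishMl _ f1P); apply: vanishB (vanishMr _ pP).
exists (c \mPo x); move/(vanish_comp x1): cP; rewrite rmorphM rmorphB rmorphM /= => cP.
have -> : a1 * f1 - (c \mPo x) * (f1 * f2) =
    ((p \mPo x) - (c \mPo x) * (P2 \mPo x)) * (P1 \mPo x) +
    (a1 - (p \mPo x)) * (P1 \mPo x) + a1 * (f1 - (P1 \mPo x))
    - (c \mPo x) * (f1 - (P1 \mPo x)) * (P2 \mPo x)
    - (c \mPo x) * f1 * (f2 - (P2 \mPo x)) by ring.
apply: vanishB (vanishMl _ f2P); apply: vanishB (vanishMr _ (vanishMl _ f1P)).
by apply: vanishD (vanishMl _ f1P); apply: vanishD cP (vanishMr _ pP).
Qed.

End Vanishing.

(** * Counting monomials *)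

Section CountingMonomials.

(** Pascal's rule: raising [d] by one adds the monomials of degree exactly [d]. *)
Lemma card_bmultinom n d : #|{: 'X_{1..n.+1 < d}}| = 'C(d + n, n.+1).
Proof.
elim: d => [|d IH].
  by rewrite add0n bin_small //; apply: eq_card0 => -[m m0]; have := m0; rewrite ltn0.
pose monomials e : seq 'X_{1..n.+1} := [seq bmnm m | m <- enum {: 'X_{1..n.+1 < e}}].
have memE e m : (m \in monomials e) = (mdeg m < e)%N.
  apply/mapP/idP => [[k _ ->]|me]; first exact: bmdeg.
  by exists (BMultinom me); rewrite ?mem_enum.
have uniqE e : uniq (monomials e) by rewrite map_inj_uniq ?enum_uniq //; apply: val_inj.
pose top := [seq s2m t | t : d.-tuple 'I_n.+1 <- enum (basis n.+1 d)].
have: perm_eq (monomials d.+1) (monomials d ++ top).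
  apply: uniq_perm => [//||m]; last first.
    by rewrite mem_cat !memE -basis_cover ltnS leq_eqVlt orbC.
  rewrite cat_uniq uniqE uniq_basis andbT; apply/hasPn => m.
  by rewrite memE -basis_cover => /eqP ->; rewrite ltnn.
move/perm_size; rewrite size_cat size_basis !size_map => sizeE.
move: IH; rewrite !cardE !enumT sizeE => ->.
by rewrite addSn binS -(bin_sub (leq_addr n d)) addKn.
Qed.

(** The binomial ['C(d + n, n.+1)] as a polynomial in [d]. *)
Definition bmultinom_poly n : {poly rat} :=
  (n.+1`!%:R)^-1 *: \prod_(i < n.+1) ('X + (n - i)%:R%:P).

Lemma bmultinom_polyE n d : (bmultinom_poly n).[d%:R] = #|{: 'X_{1..n.+1 < d}}|%:R.
Proof.
have fact0 : (n.+1)`!%:R != 0 :> rat by rewrite pnatr_eq0 -lt0n fact_gt0.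
apply: (mulfI fact0); rewrite hornerZ mulVKf // card_bmultinom -natrM mulnC bin_ffact.
rewrite ffact_prod natr_prod horner_prod; apply: eq_bigr => i _.
by rewrite !hornerE -natrD addnBA // -ltnS.
Qed.

End CountingMonomials.

(** * Truncation of power series *)

Section Truncation.
Variables (n : nat) (K : fieldType).
Implicit Types (f g : fpseries n K) (p : {mpoly K[n]}) (d : nat).

Definition trunc d f : {mpoly K[n]} := \sum_(m : 'X_{1..n < d}) f m *: 'X_[m].

Lemma mcoeff_trunc d f m : (mdeg m < d)%N -> (trunc d f)@_m = f m.
Proof. by move=> md; rewrite mcoeff_mpoly. Qed.

Lemma fpsM_trunc d f g m : (mdeg m < d)%N -> (f * g) m = (trunc d f * trunc d g)@_m.
Proof.
move=> md; rewrite (fps_mulE _ _ md) [RHS](mcoeff_poly_mul _ _ md).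
by apply: eq_bigr => k _; rewrite !mcoeff_trunc ?bmdeg.
Qed.

Lemma trunc_mul d f g : vanish d (trunc d (f * g) - trunc d f * trunc d g).
Proof. by move=> m md; rewrite mcoeffB mcoeff_trunc // (fpsM_trunc _ _ md) subrr. Qed.

Lemma mcoeff_trunc_neq0 d f m : (trunc d f)@_m != 0 -> f m != 0.
Proof.
have [md|dm] := ltnP (mdeg m) d; first by rewrite mcoeff_trunc.
rewrite raddf_sum big1 ?eqxx // => k _; rewrite /= mcoeffZ mcoeffX.
case: eqP => [km|]; last by rewrite mulr0.
by move: (bmdeg k); rewrite km ltnNge dm.
Qed.

Definition fps_of_mpoly p : fpseries n K := FPSeries (fun m => p@_m).

Lemma trunc_fps_of_mpoly d p : vanish d (trunc d (fps_of_mpoly p) - p).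
Proof. by move=> m md; rewrite mcoeffB mcoeff_trunc // subrr. Qed.

Lemma vanish_mulC d f p g q : vanish d (trunc d f - p) -> vanish d (trunc d g - q) ->
  vanish d (trunc d (f * g) - p * q).
Proof.
move=> fp gq; have -> : trunc d (f * g) - p * q =
  (trunc d (f * g) - trunc d f * trunc d g) + (trunc d f - p) * trunc d g
  + p * (trunc d g - q) by ring.
apply: vanishD (vanishMl _ gq); apply: vanishD (vanishMr _ fp); exact: trunc_mul.
Qed.

Definition ordge d f := forall m, (mdeg m < d)%N -> f m = 0.

Lemma ordge_mul d e f g : ordge d f -> ordge e g -> ordge (d + e) (f * g).
Proof.
move=> fd ge m md; rewrite (fpsM_trunc _ _ md); apply: vanishM md => k kd.
  by rewrite mcoeff_trunc ?fd // ltn_addr.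
by rewrite mcoeff_trunc ?ge // ltn_addl.
Qed.

Lemma fps_mpolyM d p f m : (mdeg m < d)%N ->
  (fps_of_mpoly p * f) m = (p * trunc d f)@_m.
Proof.
move=> md; rewrite (fpsM_trunc _ _ md); apply/eqP; rewrite -subr_eq0 -mcoeffB -mulrBl.
by apply/eqP; apply: (vanishMr _ (@trunc_fps_of_mpoly d p)).
Qed.

Lemma fps_constM c f m : (fps_of_mpoly c%:MP * f) m = c * f m.
Proof. by rewrite (fps_mpolyM _ _ (leqnn _)) mcoeffCM mcoeff_trunc. Qed.

Lemma mcoeffXM i p (m : 'X_{1..n}) :
  ('X_i * p)@_m = if (0 < m i)%N then p@_(m - U_(i)) else 0.
Proof.
case: ifPn => [mi|]; last rewrite -eqn0Ngt => /eqP mi.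
  have e : (m - U_(i) + U_(i))%MM = m by rewrite submK // lep1mP -lt0n.
  by rewrite -[in LHS]e addmC mulrC mcoeffMX.
rewrite mcoeffM big1 // => -[[k _] [l _]] /= /eqP mE.
rewrite mcoeffX; case: eqP => [kE|]; last by rewrite mul0r.
by move: mi; rewrite mE -kE mnmDE mnm1E eqxx.
Qed.

Lemma fps_XM i f m :
  (fps_of_mpoly 'X_i * f) m = if (0 < m i)%N then f (m - U_(i))%MM else 0.
Proof.
rewrite (fps_mpolyM _ _ (leqnn _)) mcoeffXM; case: ifP => // _.
by rewrite mcoeff_trunc // ltnS mdegB.
Qed.

(** The monomial order is well founded, so even an infinite support has a least element. *)
Lemma fps_exists_low f : f != 0 -> exists2 m, f m != 0 & forall k, (k < m)%O -> f k = 0.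
Proof.
move=> f0; have [m fm] : exists m, f m != 0.
  by apply: contra_notP (negP f0) => /forallNP fm; apply/eqP/fpseriesP => m;
    apply/eqP; move/negP: (fm m); rewrite negbK.
elim/(@ltmwf n): m fm => m IH fm.
have [[k km fk]|H] := pselect (exists2 k, (k < m)%O & f k != 0); first exact: IH fk.
exists m => // k km; apply/eqP; apply: contra_notT H => fk; by exists k.
Qed.

Definition coefs d f : 'rV[K]_#|{: 'X_{1..n < d}}| :=
  \row_i f (bmnm (@enum_val _ {: 'X_{1..n < d}} i)).

Lemma coefs_eq d f g : coefs d f = coefs d g <-> ordge d (f - g).
Proof.
split=> [/rowP H m md|H].
  have := H (enum_rank (BMultinom md)); rewrite !mxE enum_rankK /= => e.
  by apply/eqP; rewrite subr_eq0 e.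
apply/rowP => i; rewrite !mxE; apply/eqP; rewrite -subr_eq0; apply/eqP.
by apply: (H (enum_val i)); apply: bmdeg.
Qed.

Lemma coefs_eq0 d f : coefs d f = 0 <-> ordge d f.
Proof.
have -> : 0 = coefs d 0 by apply/rowP => i; rewrite !mxE.
by rewrite coefs_eq subr0.
Qed.

Lemma coefsD d f g : coefs d (f + g) = coefs d f + coefs d g.
Proof. by apply/rowP => i; rewrite !mxE. Qed.

Lemma coefs_const d c f : coefs d (fps_of_mpoly c%:MP * f) = c *: coefs d f.
Proof. by apply/rowP => i; rewrite !mxE fps_constM. Qed.

Definition mpoly_of_row d (v : 'rV[K]_#|{: 'X_{1..n < d}}|) : {mpoly K[n]} :=
  \sum_i v 0 i *: 'X_[bmnm (@enum_val _ {: 'X_{1..n < d}} i)].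

Lemma mcoeff_mpoly_of_row d v i : (@mpoly_of_row d v)@_(bmnm (enum_val i)) = v 0 i.
Proof.
rewrite raddf_sum (bigD1 i) //= mcoeffZ mcoeffX eqxx mulr1 big1 ?addr0 // => j ji.
rewrite mcoeffZ mcoeffX; case: eqP => [e|]; last by rewrite mulr0.
by move: ji; rewrite (enum_val_inj (val_inj e)) eqxx.
Qed.

Lemma coefs_mpoly_of_row d v : coefs d (fps_of_mpoly (mpoly_of_row v)) = v.
Proof. by apply/rowP => i; rewrite mxE /= mcoeff_mpoly_of_row. Qed.

End Truncation.

(** * Convergence of polynomials and of shifted series *)

Section ConvergentTruncation.
Variables (n : nat) (K : numFieldType).
Implicit Types (f g : cpseries n K) (p : {mpoly K[n]}).

(** Reindexes along the injection [h]; terms sent outside the range of the right-hand sum are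
    nonpositive and are dropped. *)
Lemma sum_bmultinom_le (N N' : nat) (h : 'X_{1..n} -> 'X_{1..n}) (F G : 'X_{1..n} -> K) :
    injective h -> (forall m, 0 <= F m) -> (forall m, G m <= F (h m)) ->
    (forall m, (mdeg m < N)%N -> (N' <= mdeg (h m))%N -> G m <= 0) ->
  \sum_(m : 'X_{1..n < N}) G m <= \sum_(m : 'X_{1..n < N'}) F m.
Proof.
move=> hinj F0 GF G0.
apply: (@le_trans _ K (\sum_(m : 'X_{1..n < N})
    \sum_(m' : 'X_{1..n < N'} | bmnm m' == h m) F m')).
  apply: ler_sum => m _; have [hN|hN] := ltnP (mdeg (h m)) N'.
    by rewrite (big_pred1 (BMultinom hN)) // => m'; rewrite /= bmeqP.
  by apply: le_trans (G0 _ (bmdeg m) hN) _; apply: sumr_ge0.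
rewrite (exchange_big_dep xpredT) //=; apply: ler_sum => m' _.
have [/existsP[m /eqP mE]|] := boolP [exists m : 'X_{1..n < N}, bmnm m' == h m].
  rewrite (big_pred1 m) // => k /=; rewrite mE (inj_eq hinj) eq_sym.
  exact/esym/bmeqP.
by rewrite negb_exists => /forallP H; rewrite big_pred0 // => m; apply/negbTE.
Qed.

Lemma convergent_mpoly p : fps_of_mpoly p \in @convergent n K.
Proof.
apply/asboolP; exists 1, (\sum_(m : 'X_{1..n < msize p}) `|p@_m|); split=> // N.
apply: (@sum_bmultinom_le _ _ id (fun m => `|p@_m|)
  (fun m => `|p@_m| * 1 ^+ mdeg m)) => // [m|m _ pm].
  by rewrite expr1n mulr1.
by rewrite /= memN_msupp_eq0 ?normr0 ?mul0r // msize_mdeg_ge.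
Qed.

Definition germ_of_mpoly p : cpseries n K := CPSeries (convergent_mpoly p).

(** Lowering one exponent costs a factor [r] in the bound; the guard [D] only discards terms. *)
Lemma convergent_shift f i (D : pred 'X_{1..n}) :
  FPSeries (fun m => if D m then cps_val f (m + U_(i))%MM else 0) \in @convergent n K.
Proof.
case: f => f /= /asboolP[r [M [r0 fM]]]; apply/asboolP; exists r, (M / r); split=> // N.
rewrite ler_pdivlMr // mulr_suml; apply: le_trans (fM N.+1).
apply: (@sum_bmultinom_le _ _ (fun m => (m + U_(i))%MM)
    (fun m => `|f m| * r ^+ mdeg m)
    (fun m => `|if D m then f (m + U_(i))%MM else 0| * r ^+ mdeg m * r))
  => [|m|m|m mN]; first exact: addIm.
- by rewrite mulr_ge0 // exprn_ge0 // ltW.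
- rewrite /= mdegD mdeg1 addn1 exprSr mulrA ler_pM2r // ler_pM2r ?exprn_gt0 //.
  by case: ifP; rewrite ?normr0.
- by rewrite mdegD mdeg1 addn1 ltnNge mN.
Qed.

Lemma ordge_decomp d f : ordge d.+1 f ->
  exists2 g : 'I_n -> cpseries n K, (forall i, ordge d (g i)) &
    f = \sum_i germ_of_mpoly 'X_i * g i.
Proof.
move=> fd.
(* [g i] collects the monomials of [f] whose first variable is ['X_i], divided by ['X_i]; each
   monomial of [f] thus comes from exactly one summand. *)
pose g i := CPSeries (convergent_shift f i
  (fun m => [forall j : 'I_n, (j < i)%N ==> (m j == 0%N)])).
exists g => [i m md|].
  by rewrite /=; case: ifP => // _; apply: fd; rewrite mdegD mdeg1 addn1.
apply: val_inj; apply: fpseriesP => m.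
have sumE : forall (h : 'I_n -> cpseries n K), val (\sum_i h i) m = \sum_i cps_val (h i) m.
  move=> h; rewrite raddf_sum /=.
  by elim/big_rec2: _ => // i y1 y2 _ <-.
rewrite sumE.
rewrite (eq_bigr _ (fun i _ => fps_XM i (g i) m)) /=.
have [->|m0] := eqVneq m 0%MM.
  by rewrite big1 => [|i _]; rewrite ?mnm0E // fd ?mdeg0.
have exi : exists i : nat, [exists j : 'I_n, (j == i :> nat) && (0 < m j)%N].
  move: m0; rewrite -mdeg_eq0 mdegE sum_nat_eq0 negb_forall => /existsP[j mj].
  by exists j; apply/existsP; exists j; rewrite eqxx lt0n.
case: (ex_minnP exi) => i0 /existsP[i /andP[/eqP <- mi]] min_i.
have small (j : 'I_n) : (j < i)%N -> m j = 0%N.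
  move=> ji; apply/eqP; rewrite eqn0Ngt; apply/negP => mj.
  suff /min_i : [exists k : 'I_n, (k == j :> nat) && (0 < m k)%N] by rewrite leqNgt ji.
  by apply/existsP; exists j; rewrite eqxx.
rewrite (bigD1 i) //= mi big1 ?addr0 => [|j ji].
  have -> : [forall j : 'I_n, (j < i)%N ==> ((m - U_(i))%MM j == 0%N)].
    by apply/forallP => j; apply/implyP => /small mj; rewrite mnmBE mj.
  by rewrite submK // lep1mP -lt0n.
case: ifP => // mj; case: ifP => // /forallP/(_ i)/implyP H.
have ij : (i < j)%N.
  rewrite ltn_neqAle eq_sym ji /= leqNgt; apply/negP => /small mj0.
  by rewrite mj0 in mj.
by move: (H ij); rewrite mnmBE mnm1E (negPf ji) subn0 -leqn0 leqNgt mi.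
Qed.

End ConvergentTruncation.

(** * Length as a corank *)

(* A model of a local ring [A] with residue field [K]: [F s] stands for the power
   m^s of the maximal ideal, [phi] identifies A/m^d with K^N, [const] lifts the
   residue field, and [U] is the image of the kernel of the surjection [psi].
   Composition series are obtained by repeatedly adjoining an element of m^s to
   a submodule containing m^(s+1). *)
Section Length.
Variables (A : comNzRingType) (K : fieldType) (N d : nat) (W : lmodType A).
Variables (psi : A -> W) (phi : A -> 'rV[K]_N) (const : K -> A) (F : nat -> A -> Prop).
Hypothesis psiD : forall a b, psi (a + b) = psi a + psi b.
Hypothesis psiM : forall a b, psi (a * b) = a *: psi b.
Hypothesis psi_surj : forall w, exists a, psi a = w.
Hypothesis phiD : forall a b, phi (a + b) = phi a + phi b.
Hypothesis phi_const : forall c a, phi (const c * a) = c *: phi a.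
Hypothesis phi_surj : forall v, exists a, phi a = v.
Hypothesis F0 : forall a, F 0 a.
Hypothesis Fd : forall a, F d a -> phi a = 0.
Hypothesis F_residue : forall s a b, F s b -> exists c, F s.+1 (a * b - const c * b).
Variable U : 'M[K]_N.
Hypothesis psi_ker : forall a, psi a = 0 <-> (phi a <= U)%MS.

Let phiN a : phi (- a) = - phi a.
Proof.
apply/eqP; rewrite -addr_eq0 -phiD addNr; apply/eqP.
by apply: (addrI (phi 0)); rewrite -phiD !addr0.
Qed.

Let phiB a b : phi (a - b) = phi a - phi b.
Proof. by rewrite phiD phiN. Qed.

Let psi0 : psi 0 = 0.
Proof. by rewrite -[0 in LHS](mul0r 0) psiM scale0r. Qed.

Let psiB a b : psi (a - b) = psi a - psi b.
Proof. by rewrite psiD -mulN1r psiM scaleN1r. Qed.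

(** The row spaces of such matrices are the images of ideals of [A]. *)
Let stable (M : 'M_N) := forall a b, (phi b <= M)%MS -> (phi (a * b) <= M)%MS.

Let stableU : stable U.
Proof. by move=> a b /psi_ker b0; apply/psi_ker; rewrite psiM b0 scaler0. Qed.

Let stable_step M : stable M -> (\rank M < N)%N ->
  exists2 M' : 'M_N, stable M' & (M < M')%MS /\ \rank M' = (\rank M).+1.
Proof.
move=> stM rM.
pose P s := `[< forall a, F s a -> (phi a <= M)%MS >].
have exP : exists s, P s by exists d; apply/asboolP => a /Fd ->; apply: sub0mx.
case: (ex_minnP exP) => -[|s] /asboolP sM min_s.
  have : (1%:M <= M)%MS.
    apply/rV_subP => v _; have [a <-] := phi_surj v; exact: sM.
  by move/mxrankS; rewrite mxrank1 leqNgt rM.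
have /asboolP/existsNP[a /not_implyP[Fa aM]] : ~~ P s.
  by apply/negP => /min_s; rewrite ltnn.
pose M' := (M + phi a)%MS; have MM' : (M <= M')%MS by apply: addsmxSl.
have ltM : (M < M')%MS.
  by rewrite ltmxE MM'; apply/negP => M'M; apply/aM/(submx_trans (addsmxSr M _)).
exists M'.
  move=> x b /sub_addsmxP[[u1 u2] /= bE].
  have [b1 b1E] := phi_surj (u1 *m M).
  rewrite [u2]mx11_scalar mul_scalar_mx in bE; set c := u2 0 0 in bE.
  have [c' c'P] := F_residue x Fa.
  (* All but the last term map into [M]: [b1] does, [b - b1 - const c * a] maps to 0, and
     [x * a - const c' * a] lies in m^(s+1). *)
  have -> : x * b = x * b1 + x * (b - b1 - const c * a)
      + (const c * (x * a - const c' * a) + const c * (const c' * a)) by ring.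
  rewrite !phiD !phi_const !addmx_sub ?scalemx_sub ?addsmxSr //;
    apply: submx_trans MM'; last exact: sM.
  - by apply: stM; rewrite b1E submxMl.
  - by apply: stM; rewrite !phiB phi_const bE b1E -addrA -opprD subrr sub0mx.
split=> //; apply/eqP; rewrite eqn_leq rank_ltmx // andbT.
apply: leq_trans (mxrank_adds_leqif _ _) _.
by rewrite -[X in (_ <= X)%N]addn1 leq_add2l rank_leq_row.
Qed.

Let stable_chain k M : stable M -> (\rank M + k)%N = N ->
  exists V : nat -> 'M_N, [/\ V 0 = M,
    forall i, (i <= k)%N -> stable (V i) /\ (M <= V i)%MS &
    forall i, (i < k)%N -> (V i < V i.+1)%MS].
Proof.
elim: k M => [|k IH] M stM rM; first by exists (fun=> M).
have [|M' stM' [MM' rM']] := stable_step stM.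
  by rewrite -[X in (_ < X)%N]rM addnS ltnS leq_addr.
have [|V [V0 V1 V2]] := IH M' stM'; first by rewrite rM' addSnnS.
exists (fun i => if i is j.+1 then V j else M); split=> // [[|i]|[|i]] //.
  move=> /V1[stV M'V]; split=> //; exact: submx_trans (ltmxW MM') M'V.
by rewrite V0.
exact: V2.
Qed.

Lemma module_length_corank : module_length W (N - \rank U)%N.
Proof.
split=> [|l [S [Scl Schain]]]; last first.
  (* Upper bound: along any chain, each strict inclusion raises the rank by at least one, starting
     from [\rank U]. *)
  suff H i : (i <= l)%N -> exists M : 'M_N,
      (forall a, (phi a <= M)%MS -> psi a \in S i) /\ (\rank U + i <= \rank M)%N.
    have [M [_ rM]] := H l (leqnn l).
    by rewrite leq_subRL ?rank_leq_row // (leq_trans rM) ?rank_leq_row.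
  elim: i => [|i IH] il.
    exists U; split=> [a /psi_ker ->|]; last by rewrite addn0.
    by have [] := Scl 0%N il.
  have [M [SM rM]] := IH (ltnW il).
  have [S01 [w wS wS']] := Schain i il.
  have [a aE] := psi_surj w; exists (M + phi a)%MS; split=> [b|].
    move=> /sub_addsmxP[[u1 u2] /= bE].
    have [b1 b1E] := phi_surj (u1 *m M).
    rewrite [u2]mx11_scalar mul_scalar_mx in bE; set c := u2 0 0 in bE.
    have -> : b = const c * a + (b - const c * a) by ring.
    have [_ linS] := Scl i.+1 il; rewrite psiD psiM aE; apply: linS => //.
    apply/S01/SM; rewrite phiB phi_const bE addrK; exact: submxMl.
  rewrite addnS; apply: leq_ltn_trans rM _; apply: rank_ltmx.
  rewrite ltmxE addsmxSl; apply/negP => sub; move/negP: wS'; apply.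
  by rewrite -aE; apply/SM/(submx_trans (addsmxSr M _)).
(* Lower bound: a chain of stable spaces above [U] is carried over to [W] by [psi]. *)
have [|V [V0 Vst Vlt]] := @stable_chain (N - \rank U) U stableU.
  by rewrite subnKC ?rank_leq_row.
pose S i : {pred W} := fun w => `[< exists2 a, psi a = w & (phi a <= V i)%MS >].
have SP i a : (i <= N - \rank U)%N -> (psi a \in S i) = (phi a <= V i)%MS.
  move=> /Vst[_ UV]; apply/asboolP/idP => [[b ba bV]|]; last by exists a.
  rewrite -[a](subrK b) phiD addmx_sub //; apply: submx_trans UV.
  by apply/psi_ker; rewrite psiB ba subrr.
exists S; split=> [i iN|i iN].
  split=> [|x u v]; first by rewrite -psi0 SP // -[0](subrr 0) phiB subrr sub0mx.
  have [a <-] := psi_surj u; have [b <-] := psi_surj v.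
  rewrite -psiM -psiD !SP // phiD => aV bV; apply: addmx_sub => //.
  by have [stV _] := Vst i iN; apply: stV.
have /andP[sub nsub] := Vlt i iN; split=> [w|].
  by have [a <-] := psi_surj w; rewrite !SP // 1?ltnW // => /submx_trans; apply.
have /existsNP[v /not_implyP[v1 v0]] : ~ forall v : 'rV_N, (v <= V i.+1 -> v <= V i)%MS.
  by move=> H; move/negP: nsub; apply; apply/rV_subP.
have [a av] := phi_surj v; exists (psi a); rewrite SP ?av // 1?ltnW //.
exact/negP.
Qed.

End Length.

(** * Quotients of the ring of germs *)

Section QuotientModules.
Variables (A : comNzRingType) (V : lmodType A) (X : V -> Prop).

Definition lmod_pi (v : V) : lmod_quot X := \pi_(lmod_quot X)%qT v.

Lemma lmod_piD u v : lmod_pi (u + v) = lmod_pi u + lmod_pi v.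
Proof. exact: pi_lmod_quotD. Qed.

Lemma lmod_piZ a v : lmod_pi (a *: v) = a *: lmod_pi v.
Proof. exact/esym/pi_lmod_quot_scale. Qed.

Lemma lmod_pi_surj w : exists v, lmod_pi v = w.
Proof. by have [v ->] := lmod_quot_reprK w; exists v. Qed.

Lemma lmod_pi_eq0 v : lmod_pi v = 0 <-> v \in submod_span X.
Proof.
have pi0 : lmod_pi 0 = 0 by rewrite -(scale0r 0) lmod_piZ scale0r.
rewrite -[X in X \in _]subr0 Quotient.idealrBE -pi0.
by split=> [/eqP|/eqP].
Qed.

Lemma mem_submod_span v : X v -> v \in submod_span X.
Proof. by move=> Xv; apply/asboolP => S _; apply. Qed.

Lemma submod_span_min (S : V -> Prop) :
  S 0 -> (forall a u v, S u -> S v -> S (a *: u + v)) -> (forall v, X v -> S v) ->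
  forall v, v \in submod_span X -> S v.
Proof.
move=> S0 Slin XS v /asboolP/(_ (fun u => `[< S u >])) H; apply/asboolP; apply: H.
  by split=> [|a u w /asboolP Su /asboolP Sw]; apply/asboolP; [|apply: Slin].
by move=> u /XS Su; apply/asboolP.
Qed.

End QuotientModules.

Section PrincipalSpans.
Variable A : comNzRingType.
Implicit Types (a h : A).

Lemma submod_span1 h a :
  a \in submod_span (fun x : A^o => x = h) <-> exists c, a = c * h.
Proof.
split; last by move=> [c ->]; apply: (@rpredZ _ A^o); apply: mem_submod_span.
apply: (@submod_span_min _ A^o _ (fun a : A => exists c, a = c * h)).
- by exists 0; rewrite mul0r.
- by move=> x _ _ [c ->] [c' ->]; exists (x * c + c'); rewrite mulrDl -mulrA.
- by move=> _ ->; exists 1; rewrite mul1r.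
Qed.

Lemma submod_span2 h1 h2 a :
  a \in submod_span (fun x : A^o => x = h1 \/ x = h2) <->
  exists c1 c2, a = c1 * h1 + c2 * h2.
Proof.
split; last first.
  move=> [c1 [c2 ->]]; apply: rpredD; apply: (@rpredZ _ A^o); apply: mem_submod_span.
    by left.
  by right.
apply: (@submod_span_min _ A^o _ (fun a : A => exists c1 c2, a = c1 * h1 + c2 * h2)).
- by exists 0, 0; rewrite !mul0r addr0.
- move=> x _ _ [c1 [c2 ->]] [c1' [c2' ->]]; exists (x * c1 + c1'), (x * c2 + c2').
  by rewrite [x *: _]mulrDr !mulrDl !mulrA addrACA.
- by move=> _ [->|->]; [exists 1, 0|exists 0, 1]; rewrite mul1r mul0r ?addr0 ?add0r.
Qed.

End PrincipalSpans.

Section GermQuotients.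
Variables (R : realType) (n : nat).
Local Notation A := (germ R n).
Local Notation C := (complex R).
Implicit Types (f g h : A) (d : nat).

Lemma ordge_le d e (f : fpseries n C) : (d <= e)%N -> ordge e f -> ordge d f.
Proof. by move=> de fe m md; apply: fe; apply: leq_trans de. Qed.

Lemma coefs_germD d f g : coefs d (f + g : A) = coefs d f + coefs d g.
Proof. exact: coefsD. Qed.

Lemma ordge_lin d a f g : ordge d f -> ordge d g -> ordge d (a * f + g).
Proof.
move=> fd gd; have {}fd : ordge d (a * f) by apply: (@ordge_mul _ _ 0).
by apply/coefs_eq0; rewrite coefs_germD (coefs_eq0 _ _).2 // (coefs_eq0 _ _).2 // addr0.
Qed.

Lemma germ_max_ordge f : f \in @germ_max R n <-> ordge 1 f.
Proof.
split=> [/eqP f0 m|f1]; last by apply/eqP/f1; rewrite mdeg0.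
by rewrite ltnS leqn0 mdeg_eq0 => /eqP ->.
Qed.

Lemma ideal_powS d f g : f \in @germ_max R n ->
  g \in ideal_pow (@germ_max R n) d -> f * g \in ideal_pow (@germ_max R n) d.+1.
Proof.
move=> fm; apply: (@submod_span_min _ A^o _
  (fun g : A => f * g \in ideal_pow (@germ_max R n) d.+1)).
- by rewrite mulr0; apply: (rpred0 (submod_span _)).
- move=> a u v fu fv; rewrite mulrDr mulrCA.
  by apply: rpredD => //; apply: (@rpredZ _ A^o).
move=> _ [a am ->]; apply: mem_submod_span.
exists (fun i => if unlift ord0 i is Some j then a j else f).
  by move=> i; case: unliftP => [j _|_].
rewrite big_ord_recl unlift_none; congr (_ * _).
by apply: eq_bigr => i _; rewrite liftK.
Qed.

(** Orders add under multiplication; conversely [ordge_decomp] splits off one factor in the maximal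
    ideal at a time. *)
Lemma ideal_pow_germ_max d f : f \in ideal_pow (@germ_max R n) d <-> ordge d f.
Proof.
split.
  apply: (@submod_span_min _ A^o _ (fun f : A => ordge d f)) => [m _|a u v|_ [a am ->]] //.
  - exact: ordge_lin.
  - rewrite -[d in ordge d]card_ord -sum1_card.
    apply: (big_ind2 (fun e (f : A) => ordge e f)) => // [d1 f1 d2 f2|i _].
      exact: ordge_mul.
    by apply/germ_max_ordge.
elim: d f => [|d IH] f fd.
  rewrite -[f]mulr1; apply: (@rpredZ _ A^o); apply: mem_submod_span.
  by exists (fun=> 0) => [i|]; [case: i | rewrite big_ord0].
have [g gd ->] := ordge_decomp fd.
apply: (@rpred_sum A^o) => i _; apply: ideal_powS; last exact: IH.
by apply/eqP; rewrite /= mcoeffX mnm1_eq0.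
Qed.

(** Instance of [module_length_corank]; the hypothesis says that [U] is the image modulo degree [d]
    of the ideal spanned by [X]. *)
Lemma module_length_germ_quot (X : A^o -> Prop) d
    (U : 'M[C]_#|{: 'X_{1..n < d}}|) :
  (forall a : A, (exists2 s : A, s \in submod_span X & coefs d a = coefs d s) <->
    (coefs d a <= U)%MS) ->
  module_length (mod_pow_quot (@germ_max R n) (lmod_quot X) d)
    (#|{: 'X_{1..n < d}}| - \rank U)%N.
Proof.
move=> XU.
pose psi (a : A) : mod_pow_quot (@germ_max R n) (lmod_quot X) d :=
  lmod_pi _ (lmod_pi X a).
have psiD a b : psi (a + b) = psi a + psi b by rewrite /psi !lmod_piD.
have psiM a b : psi (a * b) = a *: psi b.
  by rewrite /psi -lmod_piZ -(lmod_piZ X a b).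
apply: (@module_length_corank A C _ d _ psi (fun a => coefs d a)
   (fun c => @germ_of_mpoly n C c%:MP) (fun s a => ordge s a)) => //.
- by move=> w; have [v <-] := lmod_pi_surj w; have [a <-] := lmod_pi_surj v; exists a.
- by move=> a b; apply: coefsD.
- by move=> c a; apply: coefs_const.
- by move=> v; exists (germ_of_mpoly (mpoly_of_row v)); apply: coefs_mpoly_of_row.
- by move=> a /coefs_eq0.
- move=> s a b bs; exists (a 0%MM); rewrite -mulrBl -add1n.
  apply: ordge_mul bs => m; rewrite ltnS leqn0 mdeg_eq0 => /eqP ->.
  by rewrite /= mcoeffC eqxx mulr1 subrr.
move=> a; rewrite -XU; split=> [/lmod_pi_eq0|[s sX /coefs_eq as_d]].
  (* Elements of m^d times the quotient are represented by germs congruent modulo m^d to an element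
     of the ideal. *)
  move=> /(submod_span_min (S := fun v : lmod_quot X =>
    exists b s : A, [/\ v = lmod_pi X b, s \in submod_span X & ordge d (b - s)])).
  case.
  - by exists 0, 0; rewrite subrr; split=> //; [apply/esym/lmod_pi_eq0|]; apply: rpred0.
  - move=> x _ _ [b [s [-> sX bs]]] [b' [s' [-> s'X bs']]].
    exists (x * b + b'), (x * s + s'); split.
    + by rewrite lmod_piD -(lmod_piZ X x b).
    + by apply: rpredD => //; apply: (@rpredZ _ A^o).
    + have -> : x * b + b' - (x * s + s') = x * (b - s) + (b' - s') by ring.
      exact: ordge_lin.
  - move=> _ [x [w [/ideal_pow_germ_max xd ->]]]; have [b <-] := lmod_pi_surj w.
    exists (x * b), 0; split; [exact/esym/lmod_piZ | exact: rpred0 |].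
    by rewrite subr0 -[d]addn0; apply: ordge_mul.
  move=> b [s [ab sX bs]]; exists (a - b + s).
    apply: rpredD => //; apply/lmod_pi_eq0.
    by apply: (addIr (lmod_pi X b)); rewrite -lmod_piD subrK add0r.
  apply/coefs_eq; rewrite -[X in ordge d X]/(cps_val (a - (a - b + s))).
  by have -> : a - (a - b + s) = b - s by ring.
rewrite -[a](subrK s) psiD.
have -> : psi s = 0.
  rewrite /psi (_ : lmod_pi X s = 0); first by rewrite -(scale0r 0) lmod_piZ scale0r.
  exact/lmod_pi_eq0.
(* [a - s] lies in m^d and acts on the class of 1. *)
rewrite addr0 -[a - s]mulr1 psiM /psi -lmod_piZ; apply/lmod_pi_eq0/mem_submod_span.
by exists (a - s), (lmod_pi X 1); split=> //; apply/ideal_pow_germ_max.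
Qed.

End GermQuotients.

(** * Images of ideals in the truncated ring *)

Section IdealImages.
Variables (R : realType) (n : nat).
Local Notation A := (germ R n).
Local Notation C := (complex R).
Local Notation N d := #|{: 'X_{1..n < d}}|.
Implicit Types (f g h : A) (d : nat).

(** The matrix of multiplication by [h], from series truncated at degree [s] to series truncated at
    degree [d]. *)
Definition multiples d s h : 'M[C]_(N s, N d) :=
  \matrix_(i < N s) coefs d (fps_of_mpoly 'X_[bmnm (enum_val i)] * h).

Lemma mul_multiples d s h (v : 'rV_(N s)) :
  v *m multiples d s h = coefs d (fps_of_mpoly (mpoly_of_row v) * h).
Proof.
apply/rowP => j; rewrite !mxE (fps_mpolyM _ _ (bmdeg _)) mulr_suml raddf_sum.
apply: eq_bigr => i _; rewrite /= -scalerAl mcoeffZ; congr (_ * _).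
by rewrite !mxE (fps_mpolyM _ _ (bmdeg _)).
Qed.

(** As [h] has order at least [d - s], the class of [c * h] modulo degree [d] depends only on [c]
    modulo degree [s]. *)
Lemma sub_multiples d s h (v : 'rV_(N d)) : ordge (d - s) h ->
  (v <= multiples d s h)%MS <-> exists c : A, v = coefs d (c * h).
Proof.
move=> hd; split=> [/submxP[w ->]|[c ->]].
  by rewrite mul_multiples; exists (germ_of_mpoly (mpoly_of_row w)).
apply/submxP; exists (coefs s c); rewrite mul_multiples; apply/coefs_eq.
rewrite -[X in ordge d X]/(cps_val c * h - fps_of_mpoly (mpoly_of_row (coefs s c)) * h).
rewrite -mulrBl; apply: (@ordge_le _ _ _ (s + (d - s))); first by rewrite -leq_subLR.
by apply: ordge_mul => //; apply/coefs_eq; rewrite coefs_mpoly_of_row.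
Qed.

Definition ideal_image d h : 'M[C]_(N d) := <<multiples d d h>>%MS.

Lemma sub_ideal_image d h (v : 'rV_(N d)) :
  (v <= ideal_image d h)%MS <-> exists c : A, v = coefs d (c * h).
Proof. by rewrite genmxE; apply: sub_multiples; rewrite subnn. Qed.

Lemma mem_ideal_image d c h : (coefs d (c * h)%R <= ideal_image d h)%MS.
Proof. by apply/sub_ideal_image; exists c. Qed.

(** [e] is the order of [h]: multiplication by [h] is injective from truncations at degree [d - e]
    to truncations at degree [d]. *)
Lemma rank_ideal_image h : h != 0 ->
  exists e, forall d, (e <= d)%N -> \rank (ideal_image d h) = N (d - e).
Proof.
move=> h0; have [|a ha low] := @fps_exists_low _ _ (cps_val h); first by [].
exists (mdeg a) => d ed; set e := mdeg a.
have hd : ordge e h by move=> m ma; apply/low/lt_mdeg_ltmc.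
have -> : (ideal_image d h :=: multiples d (d - e) h)%MS.
  apply/eqmxP/andP; split; apply/rV_subP => v.
    by move/sub_ideal_image => H; apply/sub_multiples; rewrite // subKn.
  by move/sub_multiples => H; apply/sub_ideal_image/H; rewrite subKn.
apply/eqP; apply: inj_row_free => v; rewrite mul_multiples => /coefs_eq0 vh.
have [v0|v0] := eqVneq (mpoly_of_row v) 0.
  by apply/rowP => i; rewrite -mcoeff_mpoly_of_row v0 mcoeff0 mxE.
set p := mpoly_of_row v in vh v0; set b := mlast p.
have bd : (mdeg b < d - e)%N.
  rewrite ltnNge; apply: contraNN (mlast_mcoeff_neq0 v0) => db.
  rewrite raddf_sum big1 // => i _; rewrite /= mcoeffZ mcoeffX.
  case: eqP => [ib|]; last by rewrite mulr0.
  by move: (bmdeg (enum_val i)); rewrite ib ltnNge db.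
(* The lowest monomial [b + a] of the product survives truncation, with a product of two nonzero
   coefficients. *)
have abd : (mdeg (b + a) < d)%N by rewrite mdegD addnC -ltn_subRL.
have := vh _ abd; rewrite (fps_mpolyM _ _ abd).
have ad : (mdeg a < d)%N by apply: leq_ltn_trans abd; rewrite mdegD leq_addl.
have [||_ ->] := @mcoeffM_low _ _ p (trunc d h) b a.
- by move=> k; apply: mcoeff_lt_mlast.
- by move=> k ka; rewrite mcoeff_trunc ?low // (leq_ltn_trans (lemc_mdeg (ltW ka))).
move=> /eqP; rewrite mcoeff_trunc // mulf_eq0 (negPf ha) orbF.
by rewrite (negPf (mlast_mcoeff_neq0 v0)).
Qed.

Lemma module_length_quot1 d h :
  module_length (mod_pow_quot (@germ_max R n) (quot1 h) d)
    (N d - \rank (ideal_image d h))%N.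
Proof.
apply: module_length_germ_quot => a; split=> [[s /submod_span1[c ->] ->]|].
  exact: mem_ideal_image.
by move/sub_ideal_image => [c ac]; exists (c * h) => //; apply/submod_span1; exists c.
Qed.

Lemma module_length_quot2 d h1 h2 :
  module_length (mod_pow_quot (@germ_max R n) (quot2 h1 h2) d)
    (N d - \rank (ideal_image d h1 + ideal_image d h2))%N.
Proof.
apply: module_length_germ_quot => a; split.
  move=> [s /submod_span2[c1 [c2 ->]] ->]; rewrite coefs_germD; apply: addmx_sub.
    exact: submx_trans (mem_ideal_image d c1 h1) (addsmxSl _ _).
  exact: submx_trans (mem_ideal_image d c2 h2) (addsmxSr _ _).
move=> /sub_addsmxP[[u1 u2] /= aE].
have [c1 c1E] : exists c : A, u1 *m ideal_image d h1 = coefs d (c * h1).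
  by apply/sub_ideal_image; apply: submxMl.
have [c2 c2E] : exists c : A, u2 *m ideal_image d h2 = coefs d (c * h2).
  by apply/sub_ideal_image; apply: submxMl.
exists (c1 * h1 + c2 * h2); first by apply/submod_span2; exists c1, c2.
by rewrite aE c1E c2E coefs_germD.
Qed.

Lemma vanish_trunc_germ_max D f : f \in @germ_max R n -> vanish 1 (trunc D f).
Proof.
move=> /germ_max_ordge f1 m m1; apply/eqP; apply: contraTT isT.
by move/mcoeff_trunc_neq0; rewrite f1 ?eqxx.
Qed.

Lemma trunc_subst (x : 'I_n -> A) g f d D :
  (forall i, x i \in @germ_max R n) -> is_subst g x f -> (d <= D)%N ->
  vanish d (trunc d f - (trunc D g \mPo [tuple trunc D (x i) | i < n])).
Proof.
move=> xm fE dD m md; have mD := leq_trans md dD.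
set X := [tuple trunc D (x i) | i < n].
have X1 i : vanish 1 (tnth X i).
  by rewrite tnth_mktuple; apply: vanish_trunc_germ_max.
rewrite mcoeffB mcoeff_trunc // fE; set M := (mdeg m).+1.
(* The substituted series have no constant term, so cutting [g] at degree [M] keeps the coefficient
   at [m]. *)
have H : vanish M (trunc D g - trunc M g).
  by move=> k kM; rewrite mcoeffB !mcoeff_trunc ?subrr // (leq_trans kM).
have {H}/(_ m (leqnn _)) := vanish_comp X1 H.
rewrite comp_mpolyB mcoeffB => /eqP; rewrite subr_eq0 => /eqP ->.
have -> : trunc M g \mPo X =
    \sum_(b : 'X_{1..n < M}) g b *: \prod_(i < n) tnth X i ^+ b i.
  rewrite /trunc (raddf_sum (comp_mpoly X)); apply: eq_bigr => b _.
  by rewrite /= comp_mpolyZ comp_mpolyX.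
rewrite (raddf_sum (mcoeff m)) -sumrB big1 // => b _.
rewrite /= mcoeffZ -mulrBr.
have -> : cps_val (\prod_(i < n) x i ^+ b i) m =
    (trunc D (\prod_(i < n) x i ^+ b i : A))@_m by rewrite mcoeff_trunc.
rewrite -mcoeffB.
suff -> : (trunc D (\prod_(i < n) x i ^+ b i : A) - \prod_(i < n) tnth X i ^+ b i)@_m = 0.
  by rewrite mulr0.
pose P (f : A) p := vanish D (trunc D f - p).
have PM f1 p1 f2 p2 : P f1 p1 -> P f2 p2 -> P (f1 * f2) (p1 * p2).
  exact: vanish_mulC.
have P1 : P 1 1.
  by move=> k kD; rewrite mcoeffB mcoeff_trunc // mcoeff1 subrr.
suff : P (\prod_(i < n) x i ^+ b i) (\prod_(i < n) tnth X i ^+ b i) by apply.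
apply: (big_ind2 P) => // i _; elim: (b i) => [|k IH]; first by rewrite !expr0.
rewrite !exprS; apply: PM => //.
by rewrite /P tnth_mktuple subrr; apply: vanish0.
Qed.

Lemma splayed_ideal_image_cap d h1 h2 : splayed h1 h2 ->
  (ideal_image d h1 :&: ideal_image d h2 :=: ideal_image d (h1 * h2)%R)%MS.
Proof.
move=> [k [x [g1 [g2 [f1 [f2]]]]]] [_ [xm unitx] [g1D f1E] [g2D f2E]].
move=> [[u1 [v1 u1v1] f1h1] [u2 [v2 u2v2] f2h2]].
have h1E : h1 = v1 * f1 by rewrite f1h1 mulrCA mulrA u1v1 mul1r.
have h2E : h2 = v2 * f2 by rewrite f2h2 mulrCA mulrA u2v2 mul1r.
apply/eqmxP/andP; split; apply/rV_subP => v; rewrite sub_capmx.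
  move=> /andP[/sub_ideal_image[c1 v_c1] /sub_ideal_image[c2 v_c2]].
  (* Precision [d.+2] keeps the linear parts of the coordinates even for [d < 2]. *)
  set D := d.+2; have dD : (d <= D)%N by rewrite /D -addn2 leq_addr.
  have c12 :
      vanish d (trunc d (c1 * v1 : A) * trunc d f1 - trunc d (c2 * v2 : A) * trunc d f2).
    have /coefs_eq : coefs d (c1 * v1 * f1 : A) = coefs d (c2 * v2 * f2 : A).
      by rewrite -!mulrA -h1E -h2E -v_c1.
    by move=> H m md; rewrite mcoeffB -!(fpsM_trunc _ _ md); apply: H.
  have X1 i : vanish 1 (tnth [tuple trunc D (x i) | i < n] i).
    by rewrite tnth_mktuple; apply: vanish_trunc_germ_max.
  have unitX :
      \matrix_(i < n, j < n) (tnth [tuple trunc D (x i) | i < n] i)@_U_(j) \in unitmx.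
    congr (_ \in unitmx): unitx; apply/matrixP => i j.
    by rewrite !mxE tnth_mktuple mcoeff_trunc // mdeg1.
  have P1 : only_in (fun i => i < k)%N (trunc D g1).
    by move=> m i /mcoeff_trunc_neq0/g1D; apply.
  have P2 : only_in (predC (fun i : 'I_n => i < k)%N) (trunc D g2).
    by move=> m i /mcoeff_trunc_neq0/g2D + /negbNE ik; apply; rewrite -ltnNge.
  have [c cP] := splayed_syzygy X1 unitX P1 P2
    (trunc_subst xm f1E dD) (trunc_subst xm f2E dD) c12.
  (* The units enter because [f1 * f2 = u1 * u2 * (h1 * h2)]. *)
  apply/sub_ideal_image; exists (germ_of_mpoly c * u1 * u2); rewrite v_c1.
  have -> : germ_of_mpoly c * u1 * u2 * (h1 * h2) = germ_of_mpoly c * (f1 * f2).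
    by rewrite f1h1 f2h2; ring.
  rewrite h1E mulrA; apply/coefs_eq => m md.
  have := cP m md; rewrite mcoeffB -(fpsM_trunc _ _ md) => <-.
  congr (_ - _); rewrite [LHS](fps_mpolyM _ _ md); apply/eqP.
  by rewrite -subr_eq0 -mcoeffB -mulrBr (vanishMl _ (@trunc_mul _ _ d f1 f2)).
move=> /sub_ideal_image[c ->]; apply/andP; split; apply/sub_ideal_image.
  by exists (c * h2); rewrite -mulrA [h2 * _]mulrC.
by exists (c * h1); rewrite -mulrA.
Qed.

End IdealImages.

(** * Hilbert-Samuel polynomials and the additivity formula *)

Lemma corank_ideal_image_poly (R : realType) (n : nat) (h : germ R n.+1) : h != 0 ->
  exists (P : {poly rat}) d0, forall d, (d0 <= d)%N ->
    P.[d%:R] = (#|{: 'X_{1..n.+1 < d}}| - \rank (ideal_image d h))%:R.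
Proof.
move=> /rank_ideal_image[e rk].
(* With B(d) the number of monomials of degree below d, the corank is B(d) - B(d - e). *)
exists (bmultinom_poly n - (bmultinom_poly n \Po ('X - e%:R%:P))), e => d ed.
rewrite natrB ?rank_leq_row // (rk d ed) -!bmultinom_polyE natrB //.
by rewrite hornerD hornerN horner_comp !hornerE.
Qed.

Theorem proposition4p11 (R : realType) (n : nat) (h1 h2 : germ R n)
    (hD1 : reduced_equation h1) (hD2 : reduced_equation h2)
    (hD : reduced_equation (h1 * h2)) (hsplayed : splayed h1 h2) :
  exists chiD chiD12 chiD1 chiD2 : {poly rat},
    [/\ hilbert_samuel_poly (@germ_max R n) (quot1 (h1 * h2)) chiD,
        hilbert_samuel_poly (@germ_max R n) (quot2 h1 h2) chiD12,
        hilbert_samuel_poly (@germ_max R n) (quot1 h1) chiD1,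
        hilbert_samuel_poly (@germ_max R n) (quot1 h2) chiD2 &
        chiD + chiD12 = chiD1 + chiD2].
Proof.
(* Splayedness excludes [n = 0], as [1 <= k <= n - 1]. *)
case: n => [|n] in h1 h2 hD1 hD2 hD hsplayed *.
  by have [k [x [g1 [g2 [f1 [f2 [/andP[k1 kn] _ _ _ _]]]]]]] := hsplayed;
    move: (leq_trans k1 kn).
have [h10 _ _] := hD1; have [h20 _ _] := hD2; have [h120 _ _] := hD.
have [P1 [d1 P1E]] := corank_ideal_image_poly h10.
have [P2 [d2 P2E]] := corank_ideal_image_poly h20.
have [P12 [d12 P12E]] := corank_ideal_image_poly h120.
(* The polynomial of the intersection is defined by the identity itself; the rank formula then shows
   that it gives the lengths. *)
exists P12, (P1 + P2 - P12), P1, P2; split; last by rewrite addrC subrK.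
- by exists d12 => d dd; eexists; [exact: module_length_quot1 | exact: P12E].
- exists (maxn d12 (maxn d1 d2)) => d; rewrite !geq_max => /and3P[dd12 dd1 dd2].
  eexists; first exact: module_length_quot2.
  rewrite !hornerE P1E // P2E // P12E // !natrB ?rank_leq_row //.
  have /(congr1 (fun m => m%:R : rat)) :=
    mxrank_sum_cap (ideal_image d h1) (ideal_image d h2).
  by rewrite (splayed_ideal_image_cap d hsplayed) !natrD => /(canRL (addrK _)) ->; ring.
- by exists d1 => d dd; eexists; [exact: module_length_quot1 | exact: P1E].
- by exists d2 => d dd; eexists; [exact: module_length_quot1 | exact: P2E].
Qed.
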